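(* Suppose that $(\mathcal{H},W)$ is a hypernetwork and $\bowtie$ is a balanced equivalence relation on $(\mathcal{H},W)$. Then the quotient $\mathcal{H}/{\bowtie}=(\overline{\mathcal{H}},\overline{W})$ is well defined (the data defining its hyperedges and their weights do not depend on the choice of representatives). Moreover, the dynamics of $(\mathcal{H},W)$ restricted to $\Delta_{\bowtie}=\{x\in V^n:x_i=x_j\text{ whenever }i\bowtie j\}$ correspond to the evolution of the coupled cell hypernetwork $\mathcal{H}/{\bowtie}$: for every internal dynamics $f$ and every admissible family of coupling functions $Q$, under the identification of $\Delta_{\bowtie}$ with $V^p$ (one coordinate for each of the $p$ classes of $\bowtie$), the restriction to $\Delta_{\bowtie}$ of the coupled cell system defined by $(\mathcal{H},W)$, $f$, $Q$ is the coupled cell system defined by $(\overline{\mathcal{H}},\overline{W})$, $f$, $Q$.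
   Context: Directed hypergraphs. A directed hypergraph $\mathcal{H}=(C,E)$ consists of a finite set $C=\{1,\dots,n\}$ of nodes (cells) and a finite set $E$ of directed hyperedges; a directed hyperedge is a pair $e=(T(e),H(e))$ where the tail $T(e)$ is a nonempty multiset of elements of $C$ and the head $H(e)$ is a nonempty subset of $C$; $\#T(e)$ is counted with multiplicity. Each $e$ has a real weight $w_e$ (encoded in the weight matrix $W$ with $(i,j)$ entry $w_{e_j}$ if $i\in H(e_j)$ and $0$ otherwise). All hypergraphs have nonempty node and hyperedge sets and are weakly connected. Hypernetworks. A hypernetwork is a weighted directed hypergraph $(\mathcal{H},W)$ in which every node has the same phase space $V=\mathbb{R}^d$ and the same (smooth) internal dynamics $f:V\to V$. Let $BS_k(c)=\{e\in E:c\in H(e),\ \#T(e)=k\}$, $BS(c)=\bigcup_kBS_k(c)$, $B(c)=\{k:BS_k(c)\neq\emptyset\}$, $B(\mathcal{H})=\bigcup_cB(c)$. A family $Q=(Q_k)_{k\in\mathbb{N}}$ of smooth functions $Q_k:V^{k+1}\to V$, each invariant under permutations of its last $k$ arguments, is admissible if $Q_k\neq0$ for $k\in B(\mathcal{H})$ and $Q_k=0$ otherwise. The coupled cell system defined by $(\mathcal{H},W)$, $f$, $Q$ is $\dot x_i=F_i(x)=f(x_i)+\sum_{k\in B(i)}\sum_{e\in BS_k(i)}w_eQ_k(x_i;x_{T(e)})$, $i\in C$, where $x_{T(e)}$ lists the variables $x_j$, $j\in T(e)$, with multiplicity. Input equivalence $\sim_I$ on $C$: cells with empty $BS$ are equivalent;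 cells $c,c'$ with nonempty $BS$ are equivalent iff $B(c)=B(c')$ and $\sum_{e\in BS_k(c)}w_e=\sum_{e\in BS_k(c')}w_e$ for all $k\in B(c)$. Balanced relations. Let $\bowtie$ be an equivalence relation on $C$ with ordered classes $(\overline{c}_1,\dots,\overline{c}_p)$. The pattern determined by $\bowtie$ on $e$ is $\overrightarrow{m}(e)=(m_1,\dots,m_p)$, $m_i$ being the number of elements of $T(e)$ (with multiplicity) in $\overline{c}_i$. For $e\in BS_k(c)$, the weight of the pattern $\overrightarrow{m}(e)$ on $c$ is the sum of the weights of all $e'\in BS_k(c)$ with $\overrightarrow{m}(e')=\overrightarrow{m}(e)$. The relation $\bowtie$ is balanced if it refines $\sim_I$ and, for every $k\in B(\mathcal{H})$ and any two distinct cells $c\bowtie c'$, the set of patterns of hyperedges in $BS_k(c)$ coincides with that of $BS_k(c')$ and each such pattern has the same weight on both cells. Quotient. Standing convention: all hyperedges of $\mathcal{H}$ have heads of cardinality one. Let $\bowtie$ be balanced with classes $\overline{C}=(\overline{c}_1,\dots,\overline{c}_p)$. For $e\in E$ with head $\{c\}$ and pattern $\overrightarrow{m}(e)=(m_1,\dots,m_p)$, the projected hyperedge $\overline{e}$ has head $\{\overline{c}\}$ ($\overline{c}$ the class of $c$) and tail the multiset containing each $\overline{c}_i$ exactly $m_i$ times; its weight is the weight of the pattern $\overrightarrow{m}(e)$ on $c$. With $\overline{E}$ the set of projected hyperedges, $\overline{W}$ the corresponding weights and $\overline{\mathcal{H}}=(\overline{C},\overline{E})$, the quotient is $\mathcal{H}/{\bowtie}=(\overline{\mathcal{H}},\overline{W})$.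 *)

(* Defs.v *)
From HB Require Import structures.
From mathcomp Require Import all_boot all_order all_fingroup all_algebra.
From mathcomp Require Import finmap multiset generic_quotient.
From mathcomp Require Import all_classical all_reals all_analysis.

Set Implicit Arguments.
Unset Strict Implicit.
Unset Printing Implicit Defensive.

Import GRing.Theory Num.Theory.
Import numFieldNormedType.Exports.

Local Open Scope fset_scope.
Local Open Scope fmap_scope.
Local Open Scope mset_scope.
Local Open Scope quotient_scope.
Local Open Scope ring_scope.

Section Hypergraph.
Variable C : finType.

Definition hyperedge : Type := ({mset C} * {set C})%type.

Definition etail (e : hyperedge) : {mset C} := e.1.
Definition ehead (e : hyperedge) : {set C} := e.2.

(* #T(e), counted with multiplicity. *)
Definition tail_card (e : hyperedge) : nat := size (etail e).

Definition incident (e : hyperedge) (i : C) : bool :=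
  (i \in etail e) || (i \in ehead e).

Definition adjacent (E : {fset hyperedge}) : rel C :=
  fun i j => has (fun e => incident e i && incident e j) E.

Definition weakly_connected (E : {fset hyperedge}) : Prop :=
  forall i j : C, connect (adjacent E) i j.

End Hypergraph.

(* The domain of [wedges] is the set of hyperedges; its value at a hyperedge
   [e] is the weight of [e]. *)
Record hypernetwork (R : realType) (C : finType) := Hypernetwork {
  wedges : {fmap hyperedge C -> R};
  nodes_neq0 : (0 < #|C|)%N;
  edges_neq0 : domf wedges != fset0;
  tails_neq0 : forall e, e \in domf wedges -> etail e != mset0;
  heads_neq0 : forall e, e \in domf wedges -> ehead e != finset.set0;
  wedges_connected : weakly_connected (domf wedges)
}.

Section Hypernetwork.
Variables (R : realType) (C : finType) (N : hypernetwork R C).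

Definition edges : {fset hyperedge C} := domf (wedges N).

(* The default value is never reached on [edges]. *)
Definition weight (e : hyperedge C) : R := odflt 0 (wedges N).[? e].

Definition BSk (k : nat) (c : C) : {fset hyperedge C} :=
  [fset e in edges | (c \in ehead e) && (tail_card e == k)].

Definition BS (c : C) : {fset hyperedge C} :=
  [fset e in edges | c \in ehead e].

Definition Bcell (c : C) : {fset nat} := [fset tail_card e | e in BS c].

Definition Btotal : {fset nat} := \bigcup_(c in C) Bcell c.

Definition singleton_heads : Prop :=
  forall e, e \in edges -> #|ehead e| = 1%N.

Definition input_equiv (c c' : C) : Prop :=
  (BS c = fset0 /\ BS c' = fset0) \/
  [/\ BS c != fset0, BS c' != fset0, Bcell c = Bcell c' &
      forall k, k \in Bcell c ->
        \sum_(e <- BSk k c) weight e = \sum_(e <- BSk k c') weight e].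

End Hypernetwork.

Section Classes.
Variables (C : finType) (bow : equiv_rel C).

Definition quotient_cell : Type := {eq_quot bow}.

HB.instance Definition _ := EqQuotient.on quotient_cell.
HB.instance Definition _ :=
  Finite.copy quotient_cell (can_type (@EquivQuot.ereprK _ _ _ _ _ bow)).

Definition class_of (c : C) : quotient_cell := \pi_(quotient_cell) c.

(* The classes are not numbered, so a pattern (m_1, ..., m_p) is a function on
   them; [etail e i] is the multiplicity of [i] in the tail of [e]. *)
Definition pattern (e : hyperedge C) : {ffun quotient_cell -> nat} :=
  [ffun q => (\sum_(i : C | class_of i == q) etail e i)%N].

Definition proj_tail (e : hyperedge C) : {mset quotient_cell} :=
  [fsfun q in [fset q in {: quotient_cell}] => pattern e q | 0%N].

Definition proj_edge (e : hyperedge C) : hyperedge quotient_cell :=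
  (proj_tail e, class_of @: ehead e).

End Classes.

Section Quotient.
Variables (R : realType) (C : finType) (N : hypernetwork R C).
Variable bow : equiv_rel C.

Definition patterns (k : nat) (c : C) : {fset {ffun quotient_cell bow -> nat}} :=
  [fset pattern bow e | e in BSk N k c].

Definition pattern_weight (k : nat) (c : C) (m : {ffun quotient_cell bow -> nat}) : R :=
  \sum_(e <- BSk N k c | pattern bow e == m) weight N e.

Definition balanced : Prop :=
  (forall c c', bow c c' -> input_equiv N c c') /\
  (forall k, k \in Btotal N -> forall c c', c != c' -> bow c c' ->
     patterns k c = patterns k c' /\
     forall m, m \in patterns k c ->
       pattern_weight k c m = pattern_weight k c' m).

(* [proj_weight e c] is the weight prescribed for the projection of a hyperedge
   [e] with head [{c}]. *)
Definition proj_weight (e : hyperedge C) (c : C) : R :=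
  pattern_weight (tail_card e) c (pattern bow e).

(* The prescription defining the quotient, imposed for every hyperedge [e]
   projecting to a given hyperedge; that it determines exactly one
   hypernetwork is the well-definedness of the quotient. *)
Definition is_quotient (Nq : hypernetwork R (quotient_cell bow)) : Prop :=
  edges Nq = [fset proj_edge bow e | e in edges N] /\
  (forall e c, e \in edges N -> ehead e = finset.set1 c ->
     weight Nq (proj_edge bow e) = proj_weight e c).

End Quotient.

(* In finite dimension, [f] is C^(n+1) iff it is differentiable and all its
   directional derivatives are C^n. *)
Fixpoint of_class_C (R : realType) (U W : normedModType R) (n : nat)
    (f : U -> W) : Prop :=
  match n with
  | 0 => continuous f
  | n'.+1 => (forall x, differentiable f x) /\
             (forall v, of_class_C n' (fun x => 'D_v f x))
  end.

Definition smooth (R : realType) (U W : normedModType R) (f : U -> W) : Prop :=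
  forall n, of_class_C n f.

Section Dynamics.
Variables (R : realType) (d : nat).

Local Notation V := 'rV[R]_d.

(* [Q k v M] is Q_k(v; M_0, ..., M_(k-1)), the M_j being the rows of [M]. *)
Definition coupling : Type := forall k : nat, V -> 'M[R]_(k, d) -> V.

Section System.
Variables (C : finType) (N : hypernetwork R C).

Definition admissible (Q : coupling) : Prop :=
  [/\ forall k, smooth (fun z : V * 'M[R]_(k, d) => Q k z.1 z.2),
      forall k (s : 'S_k) v (M : 'M[R]_(k, d)), Q k v (row_perm s M) = Q k v M,
      forall k, k \in Btotal N -> exists v M, Q k v M != 0 &
      forall k, k \notin Btotal N -> forall v M, Q k v M = 0].

(* x_{T(e)} for a hyperedge with #T(e) = k; the default index [i] of [nth] is
   then irrelevant. *)
Definition tail_state (x : {ffun C -> V}) (i : C) (k : nat) (e : hyperedge C) :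
    'M[R]_(k, d) :=
  \matrix_(j < k) x (nth i (etail e) j).

Definition coupled_cell_system (f : V -> V) (Q : coupling)
    (x : {ffun C -> V}) : {ffun C -> V} :=
  [ffun i => f (x i) +
     \sum_(k <- Bcell N i) \sum_(e <- BSk N k i)
       weight N e *: Q k (x i) (tail_state x i k e)].

End System.

Section Synchrony.
Variables (C : finType) (bow : equiv_rel C).

Definition synchrony_space : set {ffun C -> V} :=
  [set x : {ffun C -> V} | forall i j, bow i j -> x i = x j]%classic.

(* The identification of V^p with the synchrony subspace. *)
Definition from_classes (y : {ffun quotient_cell bow -> V}) : {ffun C -> V} :=
  [ffun i => y (class_of bow i)].

End Synchrony.
End Dynamics.

(* Main.v *)
Require Import Defs.
From mathcomp Require Import all_boot all_order all_fingroup all_algebra.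
From mathcomp Require Import finmap multiset generic_quotient.
From mathcomp Require Import all_classical all_reals all_analysis.

Set Implicit Arguments.
Unset Strict Implicit.
Unset Printing Implicit Defensive.

Local Open Scope fset_scope.
Local Open Scope ring_scope.

(** The projection of a hyperedge with head [{c}] is determined by its pattern and
    the class of [c], and determines both ([proj_edge_eq]).  Balance says that two
    equivalent cells receive the same patterns with the same weights; hence the
    projected hyperedges into a class and their weights do not depend on the cell
    or the hyperedge chosen to represent them ([proj_BSk], [proj_weight_eq]).
    This prescribes the hyperedges and weights of the quotient consistently, so
    it exists; connectedness passes to the image under the class map.

    For the dynamics, a synchronous state [x] comes from a state [y] of the
    quotient.  The tail of the projection of [e] is a permutation of the list of
    classes of the tail of [e] ([perm_proj_tail]), so by symmetry of the coupling
    functions [e] and its projection contribute the same coupling value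
    ([coupling_tail_state]).  The sum over the hyperedges into [c] can then be
    grouped by projection; each group has total weight equal to the weight of the
    projected hyperedge, and the groups are exactly the hyperedges of the
    quotient into the class of [c] ([quotient_BSk], [quotient_sum]).  This
    identifies the two vector fields, and in particular the synchrony subspace is
    invariant. *)

(** * Classes, counting and connectivity *)

Lemma class_ofP (C : finType) (bow : equiv_rel C) (c c' : C) :
  reflect (class_of bow c = class_of bow c') (bow c c').
Proof. exact: eqquotP. Qed.

Lemma class_of_surj (C : finType) (bow : equiv_rel C) (q : quotient_cell bow) :
  exists c, class_of bow c = q.
Proof. by exists (repr q); rewrite /class_of reprK. Qed.

Lemma count_sum_mem (T : finType) (a : pred T) (s : seq T) :
  count a s = (\sum_(i | a i) count_mem i s)%N.
Proof.
rewrite -sum1_count (partition_big id a) //=.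
apply: eq_bigr => i ai; rewrite -sum1_count; apply: eq_bigl => j.
by rewrite /=; have [->|_] := eqVneq j i; rewrite ?ai ?andbF.
Qed.

Lemma connect_map (T U : finType) (r : rel T) (s : rel U) (h : T -> U) x y :
  (forall a b, r a b -> s (h a) (h b)) ->
  connect r x y -> connect s (h x) (h y).
Proof.
move=> rs /connectP [p]; elim: p x => [|z p IH] x /=.
  by move=> _ ->; exact: connect0.
case/andP=> rxz pz yE.
by apply: connect_trans (connect1 (rs _ _ rxz)) (IH _ pz yE).
Qed.

(** * Projected hyperedges *)

Section Projection.
Variables (C : finType) (bow : equiv_rel C).
Implicit Types e : hyperedge C.

Lemma proj_tailE e q : proj_tail bow e q = pattern bow e q.
Proof. by rewrite /proj_tail fsfunE !inE. Qed.

Lemma pattern_count e q :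
  pattern bow e q = count_mem q (map (class_of bow) (etail e)).
Proof.
rewrite ffunE count_map count_sum_mem.
by apply: eq_bigr => i _; rewrite count_mem_mset.
Qed.

(** The tail of the projection lists the classes of the tail cells: this is what
    makes a projected tail carry the same synchronous states. *)
Lemma perm_proj_tail e :
  perm_eq (proj_tail bow e) (map (class_of bow) (etail e)).
Proof.
(* Permutation is equality of all multiplicities. *)
apply/allP => q _ /=.
by rewrite count_mem_mset proj_tailE pattern_count.
Qed.

Lemma tail_card_proj e : tail_card (proj_edge bow e) = tail_card e.
Proof. by rewrite /tail_card (perm_size (perm_proj_tail e)) size_map. Qed.

Lemma eq_pattern_proj_tail e e' :
  (pattern bow e = pattern bow e') <-> (proj_tail bow e = proj_tail bow e').
Proof.
split=> E.
  by apply/msetP => q; rewrite !proj_tailE E.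
by apply/ffunP => q; rewrite -!proj_tailE E.
Qed.

Lemma proj_edge_eq e e' c c' :
  ehead e = finset.set1 c -> ehead e' = finset.set1 c' ->
  (proj_edge bow e = proj_edge bow e') <->
  (pattern bow e = pattern bow e' /\ bow c c').
Proof.
move=> he he'; rewrite /proj_edge he he' !imset_set1; split.
  by case=> /eq_pattern_proj_tail -> /set1_inj /class_ofP.
by case=> /eq_pattern_proj_tail -> /class_ofP ->.
Qed.

Lemma incident_proj e i :
  incident e i -> incident (proj_edge bow e) (class_of bow i).
Proof.
case/orP=> [it|ih]; apply/orP; last by right; apply: imset_f.
by left; rewrite (perm_mem (perm_proj_tail e)) map_f.
Qed.

End Projection.

(** * Coupling terms on synchronous states *)

Section Dynamics.
Variables (R : realType) (d : nat).
Local Notation V := 'rV[R]_d.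

(** A function of the rows of a matrix that is invariant under permutations of
    the rows depends only on the multiset indexing them. *)
Lemma symmetric_perm_eq (T : eqType) (W : Type) k (G : 'M[R]_(k, d) -> W)
    (g : T -> V) (s t : seq T) (a b : T) :
  (forall (p : 'S_k) M, G (row_perm p M) = G M) ->
  size t = k -> perm_eq s t ->
  G (\matrix_(j < k) g (nth a s j)) = G (\matrix_(j < k) g (nth b t j)).
Proof.
move=> Gsym tk; have tkP : size t == k by apply/eqP.
case/(@tuple_permP _ _ _ (Tuple tkP)) => p sE.
rewrite -[RHS](Gsym p); congr G; apply/matrixP => i j; rewrite !mxE sE.
by rewrite -tnth_nth tnth_mktuple (tnth_nth b).
Qed.

Variables (C : finType) (bow : equiv_rel C).

(** On a synchronous state, a hyperedge and its projection feed the same value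
    to a symmetric coupling function. *)
Lemma coupling_tail_state (Q : coupling R d) k v
    (y : {ffun quotient_cell bow -> V}) i e :
  (forall (p : 'S_k) (M : 'M[R]_(k, d)), Q k v (row_perm p M) = Q k v M) ->
  tail_card e == k ->
  Q k v (tail_state (from_classes y) i k e) =
  Q k v (tail_state y (class_of bow i) k (proj_edge bow e)).
Proof.
move=> Qsym /eqP ek.
rewrite /tail_state [RHS](@symmetric_perm_eq _ _ _ _ y _
  (map (class_of bow) (etail e)) _ (class_of bow i) Qsym).
- congr (Q k v _); apply/matrixP => j l; rewrite !mxE ffunE.
  by rewrite (nth_map i) // [size _]ek.
- by rewrite size_map.
- exact: perm_proj_tail.
Qed.

Lemma from_classes_bij : set_bij [set: {ffun quotient_cell bow -> V}]%classic
  (synchrony_space bow) (@from_classes R d C bow).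
Proof.
split.
- by move=> y _ i j /class_ofP ij; rewrite !ffunE ij.
- move=> y z _ _ yz; apply/ffunP => q; have [c <-] := class_of_surj q.
  by move/ffunP: yz => /(_ c); rewrite !ffunE.
- move=> x xS; exists [ffun q : quotient_cell bow => x (repr q)] => //.
  apply/ffunP => i; rewrite !ffunE; apply: xS.
  by apply/class_ofP; rewrite /class_of reprK.
Qed.

End Dynamics.

(** * Hyperedges of a hypernetwork *)

Section Hyperedges.
Variables (R : realType) (C : finType) (N : hypernetwork R C).
Implicit Types (e : hyperedge C) (c : C) (k : nat).

Lemma mem_BSk k c e :
  (e \in BSk N k c) = [&& e \in edges N, c \in ehead e & tail_card e == k].
Proof. by rewrite /BSk !inE. Qed.

Lemma mem_BcellP k c :
  reflect (exists e, e \in BSk N k c) (k \in Bcell N c).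
Proof.
apply: (iffP (imfsetP _ _ _ _)) => [[e /= eB ->]|[e]].
  by exists e; move: eB; rewrite mem_BSk eqxx andbT !inE.
rewrite mem_BSk => /and3P [eE ce /eqP kE].
by exists e => //=; rewrite !inE eE ce.
Qed.

Lemma mem_BtotalP k : reflect (exists c, k \in Bcell N c) (k \in Btotal N).
Proof.
apply: (iffP (bigfcupP _ _ _ _)) => [[c _ kc]|[c kc]]; first by exists c.
by exists c => //; rewrite mem_index_enum.
Qed.

End Hyperedges.

(** The other fields of a hypernetwork are proofs, so the hyperedges and their
    weights determine it. *)
Lemma hypernetwork_eq (R : realType) (D : finType) (M M' : hypernetwork R D) :
  edges M = edges M' -> {in edges M, weight M =1 weight M'} -> M = M'.
Proof.
move=> dE wE.
have {dE wE} : wedges M = wedges M'.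
  apply/fmapP => e; have := wE e; rewrite /weight.
  have [eM|eM] := boolP (e \in edges M); last first.
    have eM' : e \notin edges M' by rewrite -dE.
    by rewrite !not_fnd.
  have eM' : e \in edges M' by rewrite -dE.
  by move/(_ isT); rewrite !in_fnd /= => ->.
case: M => w ? ? ? ? ?; case: M' => w' ? ? ? ? ? /= E; subst w'.
by congr Hypernetwork; exact: Prop_irrelevance.
Qed.

(** * Balanced relations *)

Section Balanced.
Variables (R : realType) (C : finType) (N : hypernetwork R C).
Variable bow : equiv_rel C.
Implicit Types (e : hyperedge C) (c : C) (k : nat).

Hypothesis heads1 : singleton_heads N.

Lemma head_BSk k c e : e \in BSk N k c -> ehead e = finset.set1 c.
Proof.
rewrite mem_BSk => /and3P [/heads1 /eqP /cards1P [a ->] + _].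
by rewrite finset.in_set1 => /eqP ->.
Qed.

Lemma head_ex e : e \in edges N -> exists c, ehead e = finset.set1 c.
Proof. by move/heads1/eqP/cards1P. Qed.

Hypothesis bal : balanced N bow.

(** The definition of balance only speaks of distinct cells and of the
    cardinalities that occur; equality of the pattern sets holds for all. *)
Lemma balanced_patterns k c c' : bow c c' ->
  patterns N bow k c = patterns N bow k c'.
Proof.
move=> cc'; have [->//|ne] := eqVneq c c'.
have [kT|kT] := boolP (k \in Btotal N); first by case: (bal.2 k kT _ _ ne cc').
suff B0 a : BSk N k a = fset0 by rewrite /patterns !B0.
apply/fsetP => e; rewrite in_fset0; apply/negP => eB.
by case/negP: kT; apply/mem_BtotalP; exists a; apply/mem_BcellP; exists e.
Qed.

Lemma balanced_weight k c c' e : bow c c' -> e \in BSk N k c ->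
  pattern_weight N k c (pattern bow e) = pattern_weight N k c' (pattern bow e).
Proof.
move=> cc' eB; have [->//|ne] := eqVneq c c'.
have kT : k \in Btotal N.
  by apply/mem_BtotalP; exists c; apply/mem_BcellP; exists e.
case: (bal.2 k kT _ _ ne cc') => _; apply.
by apply/imfsetP; exists e.
Qed.

Lemma balanced_pattern_ex k c c' e : bow c c' -> e \in BSk N k c ->
  exists2 e', e' \in BSk N k c' & pattern bow e' = pattern bow e.
Proof.
move=> /balanced_patterns E eB.
have : pattern bow e \in patterns N bow k c by apply/imfsetP; exists e.
by rewrite E => /imfsetP [e' /= e'B ->]; exists e'.
Qed.

Lemma proj_BSk_sub k c c' e : bow c c' -> e \in BSk N k c ->
  proj_edge bow e \in [fset proj_edge bow e | e in BSk N k c'].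
Proof.
move=> cc' eB; have [e' e'B pE] := balanced_pattern_ex cc' eB.
apply/imfsetP; exists e' => //=.
by apply/(proj_edge_eq bow (head_BSk eB) (head_BSk e'B)).
Qed.

Lemma proj_BSk c c' : bow c c' -> forall k,
  [fset proj_edge bow e | e in BSk N k c] =
  [fset proj_edge bow e | e in BSk N k c'].
Proof.
move=> cc' k; have c'c : bow c' c by apply/class_ofP/esym/class_ofP.
apply/eqP; rewrite eqEfsubset; apply/andP; split; apply/fsubsetP => x;
  by case/imfsetP => e /= eB ->; apply: proj_BSk_sub eB.
Qed.

Lemma proj_weight_eq e e' c c' : e \in edges N -> e' \in edges N ->
  ehead e = finset.set1 c -> ehead e' = finset.set1 c' ->
  proj_edge bow e = proj_edge bow e' ->
  proj_weight N bow e c = proj_weight N bow e' c'.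
Proof.
move=> eE e'E he he' pE.
have [patE cc'] := (proj_edge_eq bow he he').1 pE.
rewrite /proj_weight -patE -(tail_card_proj bow e') -pE tail_card_proj.
by apply: balanced_weight cc' _; rewrite mem_BSk eE he finset.set11 /=.
Qed.

(** * Existence and uniqueness of the quotient *)

Lemma quotient_exists :
  exists Nq : hypernetwork R (quotient_cell bow), is_quotient N Nq.
Proof.
(* A weight for every potential hyperedge of the quotient, with the prescribed
   value on the projected ones. *)
have [q|w wP] := @choice _ _
  (fun (q : hyperedge (quotient_cell bow)) (r : R) =>
    forall e c, e \in edges N -> ehead e = finset.set1 c ->
      proj_edge bow e = q -> r = proj_weight N bow e c).
  have [[e [c [eE he pE]]]|ne] := pselect (exists e c,
      [/\ e \in edges N, ehead e = finset.set1 c & proj_edge bow e = q]).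
    exists (proj_weight N bow e c) => e' c' e'E he' pE'.
    by apply: proj_weight_eq => //; rewrite pE pE'.
  (* No hyperedge with a singleton head projects to [q]: any value will do. *)
  by exists 0 => e c eE he pE; case: ne; exists e, c.
pose E := [fset proj_edge bow e | e in edges N].
pose m : {fmap hyperedge (quotient_cell bow) -> R} :=
  [fmap x : E => w (val x)].
have EP e : e \in edges N -> proj_edge bow e \in E.
  by move=> eE; apply/imfsetP; exists e.
have dm : domf m = E by [].
have h1 : (0 < #|{: quotient_cell bow}|)%N.
  have /card_gt0P [c _] := nodes_neq0 N.
  by apply/card_gt0P; exists (class_of bow c).
have h2 : domf m != fset0.
  have /fset0Pn [e eE] := edges_neq0 N.
  by apply/fset0Pn; exists (proj_edge bow e); apply: EP.
have h3 q : q \in domf m -> etail q != mset0.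
  rewrite dm => /imfsetP [e /= eE ->].
  apply: contraNneq (tails_neq0 eE) => t0.
  have : tail_card e = 0%N.
    by rewrite -(tail_card_proj bow) /tail_card t0 enum_mset0.
  move/size0nil => e0; apply/eqP/msetP => a.
  by rewrite -count_mem_mset e0 mset0E.
have h4 q : q \in domf m -> ehead q != finset.set0.
  rewrite dm => /imfsetP [e /= eE ->].
  by rewrite imset_eq0; exact: (heads_neq0 eE).
have h5 : weakly_connected (domf m).
  move=> q q'; have [[i <-] [j <-]] := (class_of_surj q, class_of_surj q').
  apply: connect_map (wedges_connected N i j) => a b.
  case/hasP => e eE /andP [ea eb]; apply/hasP.
  by exists (proj_edge bow e); [apply: EP|rewrite !incident_proj].
exists (Hypernetwork h1 h2 h3 h4 h5); split=> // e c eE he.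
rewrite /weight /= in_fnd /=; first by apply: EP.
by move=> eE'; rewrite ffunE /=; apply: wP he _.
Qed.

(** Every hyperedge of a quotient is projected from one with a singleton head,
    so its weight is prescribed. *)
Lemma quotient_unique (M M' : hypernetwork R (quotient_cell bow)) :
  is_quotient N M -> is_quotient N M' -> M = M'.
Proof.
move=> [dM wM] [dM' wM']; apply: hypernetwork_eq; first by rewrite dM dM'.
move=> q; rewrite dM => /imfsetP [e /= eE ->].
by have [c he] := head_ex eE; rewrite (wM _ _ eE he) (wM' _ _ eE he).
Qed.

(** * Dynamics of the quotient *)

Section QuotientProperties.
Variable Nq : hypernetwork R (quotient_cell bow).
Hypothesis NqP : is_quotient N Nq.

(** A hyperedge of the quotient into the class of [c] may come from a hyperedge
    into another cell of that class; by balance it also comes from one into [c]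
    itself. *)
Lemma quotient_BSk k c :
  BSk Nq k (class_of bow c) = [fset proj_edge bow e | e in BSk N k c].
Proof.
apply/fsetP => q; apply/idP/imfsetP => /= [|[e eB ->]].
  rewrite /BSk !inE NqP.1 => /and3P [/imfsetP [e /= eE ->] ch].
  have [c' he] := head_ex eE.
  move: ch; rewrite /= he imset_set1 finset.in_set1 => /eqP /esym /class_ofP c'c.
  rewrite tail_card_proj => ek.
  have eB : e \in BSk N k c' by rewrite mem_BSk eE he finset.set11.
  by have /imfsetP [e' /= e'B ->] := proj_BSk_sub c'c eB; exists e'.
have he := head_BSk eB; move: eB; rewrite mem_BSk => /and3P [eE _ ek].
rewrite /BSk !inE NqP.1 tail_card_proj ek /= he imset_set1 finset.set11 !andbT.
by apply/imfsetP; exists e.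
Qed.

Lemma quotient_Bcell c : Bcell Nq (class_of bow c) = Bcell N c.
Proof.
apply/fsetP => k; apply/mem_BcellP/mem_BcellP => -[e].
  by rewrite quotient_BSk => /imfsetP [e' e'B _]; exists e'.
by exists (proj_edge bow e); rewrite quotient_BSk; apply/imfsetP; exists e.
Qed.

Lemma quotient_Btotal : Btotal Nq = Btotal N.
Proof.
apply/fsetP => k; apply/mem_BtotalP/mem_BtotalP => -[c kc]; last first.
  by exists (class_of bow c); rewrite quotient_Bcell.
by have [c' cE] := class_of_surj c; exists c'; rewrite -quotient_Bcell cE.
Qed.

(** Grouping the hyperedges into [c] by their projection replaces the weights
    of a group by their sum, which is the weight of the projected hyperedge. *)
Lemma quotient_sum (W : lmodType R) k c
    (G : hyperedge (quotient_cell bow) -> W) :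
  \sum_(e <- BSk N k c) weight N e *: G (proj_edge bow e) =
  \sum_(q <- BSk Nq k (class_of bow c)) weight Nq q *: G q.
Proof.
rewrite quotient_BSk (partition_big_imfset _ (proj_edge bow)) /=.
apply: eq_fbigr => q /imfsetP [e0 /= e0B ->] _.
have h0 := head_BSk e0B.
have := e0B; rewrite mem_BSk => /and3P [e0E _ /eqP k0].
rewrite (NqP.2 _ _ e0E h0) /proj_weight /pattern_weight k0 GRing.scaler_suml.
rewrite big_seq_cond [RHS]big_seq_cond.
apply: eq_big => e; last by case/andP=> _ /eqP ->.
apply: andb_id2l => eB.
apply/eqP/eqP => [|pE]; first by case/(proj_edge_eq bow (head_BSk eB) h0).
by apply/(proj_edge_eq bow (head_BSk eB) h0).
Qed.

Section QuotientDynamics.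
Variable d : nat.
Local Notation V := 'rV[R]_d.

Lemma quotient_admissible (Q : coupling R d) :
  admissible N Q -> admissible Nq Q.
Proof. by case=> *; split; rewrite ?quotient_Btotal. Qed.

Lemma quotient_dynamics (f : V -> V) (Q : coupling R d) y :
  admissible N Q ->
  coupled_cell_system N f Q (from_classes y) =
  from_classes (coupled_cell_system Nq f Q y).
Proof.
move=> [_ Qsym _ _]; apply/ffunP => i; rewrite !ffunE; congr (_ + _).
rewrite quotient_Bcell; apply: eq_bigr => k _.
rewrite -(@quotient_sum V k i
  (fun q => Q k (y (class_of bow i)) (tail_state y (class_of bow i) k q))).
apply: eq_fbigr => e eB _; congr (_ *: _).
by apply: coupling_tail_state => //; move: eB; rewrite mem_BSk => /and3P [].
Qed.

End QuotientDynamics.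

End QuotientProperties.

End Balanced.

Theorem theorem4p13 (R : realType) (C : finType) (N : hypernetwork R C)
    (bow : equiv_rel C) :
  singleton_heads N ->
  balanced N bow ->
  [/\ forall c c', bow c c' -> forall k,
        [fset proj_edge bow e | e in BSk N k c] =
        [fset proj_edge bow e | e in BSk N k c'],
      forall e e' c c', e \in edges N -> e' \in edges N ->
        ehead e = finset.set1 c -> ehead e' = finset.set1 c' ->
        proj_edge bow e = proj_edge bow e' ->
        proj_weight N bow e c = proj_weight N bow e' c',
      exists! Nq : hypernetwork R (quotient_cell bow), is_quotient N Nq &
      forall Nq : hypernetwork R (quotient_cell bow), is_quotient N Nq ->
      forall d : nat,
        set_bij [set: {ffun quotient_cell bow -> 'rV[R]_d}]%classic
                (synchrony_space bow) (@from_classes R d C bow) /\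
        forall (f : 'rV[R]_d -> 'rV[R]_d) (Q : coupling R d),
          smooth f -> admissible N Q ->
          [/\ admissible Nq Q,
              forall x, synchrony_space bow x ->
                synchrony_space bow (coupled_cell_system N f Q x) &
              forall y, coupled_cell_system N f Q (from_classes y) =
                        from_classes (coupled_cell_system Nq f Q y)]].
Proof.
move=> heads1 bal; split.
- by move=> c c' cc'; apply: proj_BSk.
- by move=> e e' c c'; apply: proj_weight_eq.
- have [M MP] := quotient_exists bal.
  by exists M; split=> // M'; apply: quotient_unique.
move=> M MP d; split; first exact: from_classes_bij.
move=> f Q _ QP.
have dyn y := quotient_dynamics heads1 bal MP f y QP.
split=> // [|x xS]; first exact: quotient_admissible QP.
have [sync _ /(_ x xS) [y _ <-]] := from_classes_bij R d bow.
by rewrite dyn; apply: sync.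
Qed.
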